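(* Let $x_1,\dots,x_n\in\mathbb{R}^d$, $y_1,\dots,y_n\in\{0,1\}$, $\iota>0$, and $$U(q)=\frac1n\sum_{i=1}^n\varphi\left(y_i-h(\langle q,x_i\rangle)\right)+\frac\iota2|q|^2,\qquad q\in\mathbb{R}^d.$$ Assume $B_x:=\max_i|x_i|<\infty$; $h\in C^2(\mathbb{R})$ with $H_1:=\sup|h'|<\infty$, $H_2:=\sup|h''|<\infty$; and $\varphi\ge0$, $\varphi\in C^2(\mathbb{R})$ with $\Phi_1:=\sup|\varphi'|<\infty$, $\Phi_2:=\sup|\varphi''|<\infty$. Then: (a) $U\in C^2(\mathbb{R}^d)$, $U\ge0$, and $\nabla U$ is $L$-Lipschitz with $L:=\iota+(\Phi_2H_1^2+\Phi_1H_2)B_x^2$. (b) $U$ is dissipative in the sense stated in the context. In particular, with $C_0:=\Phi_1H_1B_x$, $\langle\nabla U(q),q\rangle\ge\frac\iota2|q|^2-\frac{C_0^2}{2\iota}$ for all $q\in\mathbb{R}^d$. (c) $U$ satisfies the asymptotically linear gradient assumption stated in the context with $Q_\infty:=\iota I_d$ and $\varrho(r):=\frac{C_0}{r}$ for $r\ge1$.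
   Context: $|\cdot|$ is the Euclidean norm; $\gamma>0$ is a fixed friction parameter. Dissipativity: there are $\lambda\in(0,1/4]$ and $A\in(0,\infty)$ such that $\frac12q\cdot\nabla U(q)\ge\lambda(U(q)+\frac{\gamma^2}{4}|q|^2)-A$ for all $q\in\mathbb{R}^d$. Asymptotically linear gradient assumption: there are $C_{\mathrm{linear}}>0$, a symmetric positive definite $Q_\infty\in\mathbb{R}^{d\times d}$ and a nonincreasing function $\varrho$ with $\varrho(r)\to0$ as $r\to\infty$ such that $|\nabla U(q)-Q_\infty q|\le\varrho(|q|)|q|$ for $|q|\ge C_{\mathrm{linear}}$ (only the values of $\varrho$ on $[C_{\mathrm{linear}},\infty)$ matter; here $C_{\mathrm{linear}}=1$). *)

(* Defs.v *)
From HB Require Import structures.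
From mathcomp Require Import all_boot all_order all_algebra.
From mathcomp Require Import all_classical all_reals all_analysis.
Set Implicit Arguments.
Unset Strict Implicit.
Unset Printing Implicit Defensive.
Import Order.TTheory GRing.Theory Num.Theory.
Import numFieldNormedType.Exports.
Local Open Scope ring_scope.
Local Open Scope classical_set_scope.

(* R^d is 'cV[R]_d, whose library norm `|q| is the sup norm:
   it is used only through its topology (limits, differentiability), and every
   quantitative bound uses the Euclidean norm enorm. *)

Definition inner (R : realType) (d : nat) (p q : 'cV[R]_d) : R :=
  \sum_(i < d) p i 0 * q i 0.

Definition enorm (R : realType) (d : nat) (q : 'cV[R]_d) : R :=
  Num.sqrt (inner q q).

Definition gradient (R : realType) (d : nat) (U : 'cV[R]_d -> R)
    (q : 'cV[R]_d) : 'cV[R]_d :=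
  \col_i 'D_(delta_mx i 0) U q.

(* Class C^k on a finite-dimensional space V. By linearity of v |-> 'D_v f x for
   a differentiable f, quantifying over all directions v amounts to quantifying
   over the partial derivatives. *)
Fixpoint class_C (k : nat) (R : realType) (V : normedModType R)
    (f : V -> R) : Prop :=
  if k is k'.+1 then
    (forall x, differentiable f x) /\ (forall v, class_C k' ('D_v f))
  else continuous f.

Definition bounded_abs (R : realType) (f : R -> R) : Prop :=
  has_ubound (range (fun t => `|f t|)).

(* Meaningful only when bounded_abs f holds: sup is 0 on unbounded sets. *)
Definition sup_abs (R : realType) (f : R -> R) : R :=
  sup (range (fun t => `|f t|)).

Definition elipschitz (R : realType) (d : nat) (L : R)
    (F : 'cV[R]_d -> 'cV[R]_d) : Prop :=
  forall p q, enorm (F p - F q) <= L * enorm (p - q).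

Definition dissipative (R : realType) (d : nat) (gamma : R)
    (U : 'cV[R]_d -> R) : Prop :=
  exists lambda A : R, [/\ 0 < lambda, lambda <= 4%:R^-1, 0 < A &
    forall q, lambda * (U q + gamma ^+ 2 / 4%:R * enorm q ^+ 2) - A
              <= 2%:R^-1 * inner q (gradient U q)].

Definition posdef_sym (R : realType) (d : nat) (Q : 'M[R]_d) : Prop :=
  Q^T = Q /\ forall q : 'cV[R]_d, q != 0 -> 0 < inner q (Q *m q).

(* Only the values of rho on [C, +oo) matter. *)
Definition asymp_linear_gradient (R : realType) (d : nat) (U : 'cV[R]_d -> R)
    (C : R) (Q : 'M[R]_d) (rho : R -> R) : Prop :=
  [/\ 0 < C,
      posdef_sym Q,
      (forall r s, C <= r -> r <= s -> rho s <= rho r),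
      rho r @[r --> +oo] --> 0 &
      forall q, C <= enorm q ->
        enorm (gradient U q - Q *m q) <= rho (enorm q) * enorm q].

(* Main.v *)
(* Each summand is a ridge function g_i(<q, x_i>) with g_i t = phi (y_i - h t), and
   |g_i'| <= Phi1 H1, |g_i''| <= Phi2 H1^2 + Phi1 H2. Hence grad U q - iota q, the
   mean of the vectors g_i'(<q, x_i>) x_i, has norm at most C0 (this gives (c)) and
   is Lipschitz by the mean value theorem and Cauchy-Schwarz (this gives (a)). The
   lower bound in (b) is Young's inequality C0 |q| <= iota/2 |q|^2 + C0^2/(2 iota);
   the same inequality bounds U by a constant plus iota |q|^2, so dissipativity
   holds with lambda = iota / (4 iota + gamma^2). *)
Require Import Defs.
From HB Require Import structures.
From mathcomp Require Import all_boot all_order all_algebra.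
From mathcomp Require Import all_classical all_reals all_analysis.
From mathcomp Require Import ring lra.
Set Implicit Arguments.
Unset Strict Implicit.
Unset Printing Implicit Defensive.
Import Order.TTheory GRing.Theory Num.Theory.
Import numFieldNormedType.Exports.
Local Open Scope ring_scope.
Local Open Scope classical_set_scope.

(** * Euclidean inner product and norm on column vectors *)

Section Euclidean.
Context {R : realType} {d : nat}.
Implicit Types p q r : 'cV[R]_d.

Lemma innerC p q : inner p q = inner q p.
Proof. by apply: eq_bigr => i _; rewrite mulrC. Qed.

Lemma innerDl p q r : inner (p + q) r = inner p r + inner q r.
Proof. by rewrite -big_split; apply: eq_bigr => i _; rewrite !mxE mulrDl. Qed.

Lemma innerZl a p q : inner (a *: p) q = a * inner p q.
Proof. by rewrite /inner mulr_sumr; apply: eq_bigr => i _; rewrite !mxE mulrA. Qed.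

Lemma innerDr p q r : inner r (p + q) = inner r p + inner r q.
Proof. by rewrite !(innerC r) innerDl. Qed.

Lemma innerZr a p q : inner q (a *: p) = a * inner q p.
Proof. by rewrite !(innerC q) innerZl. Qed.

Lemma innerBl p q r : inner (p - q) r = inner p r - inner q r.
Proof. by rewrite -scaleN1r innerDl innerZl mulN1r. Qed.

Lemma inner_suml (I : Type) (s : seq I) (F : I -> 'cV[R]_d) r :
  inner (\sum_(i <- s) F i) r = \sum_(i <- s) inner (F i) r.
Proof.
elim/big_ind2 : _ => // [|p a q b <- <-]; last exact: innerDl.
by rewrite -(scale0r r) innerZl mul0r.
Qed.

Lemma inner_ge0 p : 0 <= inner p p.
Proof. by apply: sumr_ge0 => i _; rewrite -expr2 sqr_ge0. Qed.

Lemma inner_eq0 p : inner p p = 0 -> p = 0.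
Proof.
move=> /eqP; rewrite psumr_eq0 => [|i _]; last by rewrite -expr2 sqr_ge0.
move=> /allP p0; apply/matrixP => i j; rewrite ord1 mxE.
have := p0 i; rewrite mem_index_enum -expr2 sqrf_eq0 => /(_ isT).
by move=> /eqP.
Qed.

Lemma inner_gt0 p : p != 0 -> 0 < inner p p.
Proof.
by move=> p0; rewrite lt0r inner_ge0 andbT; apply: contra_neq p0; exact: inner_eq0.
Qed.

Lemma inner_delta_mxl i p : inner (delta_mx i 0) p = p i 0.
Proof.
rewrite /inner (bigD1 i)//= mxE !eqxx mul1r big1 ?addr0// => j ji.
by rewrite mxE (negbTE ji) mul0r.
Qed.

Lemma enorm_ge0 p : 0 <= enorm p.
Proof. exact: sqrtr_ge0. Qed.

Lemma sqr_enorm p : enorm p ^+ 2 = inner p p.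
Proof. by rewrite sqr_sqrtr// inner_ge0. Qed.

Lemma enormZ a p : enorm (a *: p) = `|a| * enorm p.
Proof.
by rewrite /enorm innerZl innerZr mulrA -expr2 sqrtrM ?sqr_ge0// sqrtr_sqr.
Qed.

Lemma enorm0 : enorm (0 : 'cV[R]_d) = 0.
Proof. by rewrite -(scale0r 0) enormZ normr0 mul0r. Qed.

Lemma cauchy_schwarz_inner p q : `|inner p q| <= enorm p * enorm q.
Proof.
rewrite -(@ler_pXn2r _ 2)// ?nnegrE ?mulr_ge0 ?enorm_ge0//.
rewrite exprMn !sqr_enorm real_normK ?num_real//.
have [->|/inner_gt0 q0] := eqVneq q 0.
  by rewrite -(scale0r 0) innerC !innerZl !mul0r expr0n mulr0.
(* [<r, r> = <q, q> (<q, q> <p, p> - <p, q>^2)] for [r = <q, q> p - <p, q> q] *)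
have := inner_ge0 (inner q q *: p - inner p q *: q).
rewrite -scaleNr innerDl !innerDr !innerZl !innerZr (innerC q p) => h.
rewrite -subr_ge0 -(pmulr_rge0 _ q0).
by apply: le_trans h _; rewrite le_eqVlt; apply/orP; left; apply/eqP; ring.
Qed.

Lemma enormD p q : enorm (p + q) <= enorm p + enorm q.
Proof.
rewrite -(@ler_pXn2r _ 2)// ?nnegrE ?addr_ge0 ?enorm_ge0//.
rewrite sqrrD !sqr_enorm innerDl !innerDr (innerC q p).
have := le_trans (ler_norm _) (cauchy_schwarz_inner p q); lra.
Qed.

Lemma enorm_sum (I : Type) (s : seq I) (F : I -> 'cV[R]_d) :
  enorm (\sum_(i <- s) F i) <= \sum_(i <- s) enorm (F i).
Proof.
elim/big_ind2 : _ => // [|p a q b pa qb]; first by rewrite enorm0.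
by rewrite (le_trans (enormD _ _)) ?lerD.
Qed.

End Euclidean.

(** * Closure of the classes C^k under sums, products and composition *)

Section ClassC.
Context {R : realType} {V : normedModType R}.
Implicit Types f g : V -> R.

Lemma class_C_continuous k f : class_C k f -> continuous f.
Proof. by case: k => // k [df _] x; exact: differentiable_continuous. Qed.

Lemma class_CW k f : class_C k.+1 f -> class_C k f.
Proof.
elim: k f => [|k ih] f; first exact: class_C_continuous.
by move=> [df Df]; split=> // v; exact/ih/Df.
Qed.

Lemma class_C_cst k (a : R) : class_C k (fun _ : V => a).
Proof.
elim: k a => [|k ih] a; first by move=> x; exact: cst_continuous.
split=> [x|v]; first exact: differentiable_cst.
by rewrite (_ : 'D_v _ = fun=> 0)//; apply/funext => x; exact: derive_cst.
Qed.

Lemma class_CD k f g :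
  class_C k f -> class_C k g -> class_C k (fun x => f x + g x).
Proof.
elim: k f g => [|k ih] f g; first by move=> cf cg x; exact: (cvgD (cf x) (cg x)).
move=> [df Df] [dg Dg]; split=> [x|v]; first exact: differentiableD.
rewrite (_ : 'D_v _ = fun x => 'D_v f x + 'D_v g x); first exact: ih (Df v) (Dg v).
by apply/funext => x; apply: deriveD; exact: diff_derivable.
Qed.

Lemma class_CM k f g :
  class_C k f -> class_C k g -> class_C k (fun x => f x * g x).
Proof.
elim: k f g => [|k ih] f g; first by move=> cf cg x; exact: (cvgM (cf x) (cg x)).
move=> Cf Cg; have [[df Df] [dg Dg]] := (Cf, Cg).
split=> [x|v]; first exact: differentiableM.
(* The Leibniz rule keeps one factor undifferentiated. That factor is of class k+1, so [class_CW]
   lowers it to class k before the induction hypothesis applies. *)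
rewrite (_ : 'D_v _ = fun x => f x * 'D_v g x + g x * 'D_v f x).
  by apply: class_CD; [apply: ih (Dg v)|apply: ih (Df v)]; exact: class_CW.
by apply/funext => x; apply: deriveM; exact: diff_derivable.
Qed.

Lemma class_C_sum k n (f : 'I_n -> V -> R) :
  (forall i, class_C k (f i)) -> class_C k (fun x => \sum_(i < n) f i x).
Proof.
elim: n f => [|n ih] f Cf.
  by under eq_fun do rewrite big_ord0; exact: class_C_cst.
under eq_fun do rewrite big_ord_recl.
by apply: class_CD => //; exact: ih.
Qed.

Lemma class_CN k f : class_C k f -> class_C k (fun x => - f x).
Proof.
move=> Cf; under eq_fun do rewrite -mulN1r.
by apply: class_CM => //; exact: class_C_cst.
Qed.

Lemma derive_comp_real (f : R -> R) g x v :
  differentiable f (g x) -> differentiable g x ->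
  'D_v (fun x => f (g x)) x = (f^`() (g x))%classic * 'D_v g x.
Proof.
move=> df dg; rewrite (deriveE _ (differentiable_comp dg df)) diff_comp//=.
(* The differential of [f] is linear on the line, hence multiplication by its value at 1, which is
   the derivative of [f]. *)
by rewrite (deriveE _ dg) derive1E' //= -[X in 'd f _ X]mulr1 linearZ/= mulrC.
Qed.

Lemma class_C_comp k (f : R -> R) g :
  class_C k f -> class_C k g -> class_C k (fun x => f (g x)).
Proof.
elim: k f g => [|k ih] f g.
  by move=> cf cg x; apply: continuous_comp; [exact: cg|exact: cf].
move=> [df Df] Cg; have [dg Dg] := Cg.
split=> [x|v]; first exact: differentiable_comp.
(* In the chain rule the derivative of [f] is written as a derivative in direction 1, the form in
   which [Df] provides its regularity. *)
rewrite (_ : 'D_v _ = fun x => 'D_1 f (g x) * 'D_v g x).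
  by apply: class_CM; [apply: ih (Df 1) (class_CW Cg)|exact: Dg].
by apply/funext => x; rewrite derive_comp_real// derive1E.
Qed.

End ClassC.

Lemma class_C_derive1 {R : realType} k (f : R -> R) :
  class_C k.+1 f -> class_C k f^`().
Proof.
move=> [_ /(_ 1)]; congr class_C; by apply/funext => x; rewrite derive1E.
Qed.


(** * Derivatives of linear forms and of the squared Euclidean norm *)

Section InnerCalculus.
Context {R : realType} {d : nat}.
Implicit Types p q v w : 'cV[R]_d.

Lemma continuous_inner w : continuous (fun q => inner q w).
Proof.
apply: (@class_C_continuous _ _ 0).
apply: class_C_sum => i; apply: class_CM; first exact: coord_continuous.
exact: class_C_cst.
Qed.

Let inner_linear w : linear (fun q => inner q w).
Proof. by move=> a p q; rewrite innerDl innerZl. Qed.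

(** Bundled as a linear map so that continuity yields differentiability and the map is its own
    differential. *)
Let innerL w : {linear 'cV[R]_d -> R} :=
  HB.pack (fun q => inner q w) (GRing.isLinear.Build _ _ _ _ _ (inner_linear w)).

Lemma differentiable_inner w q : differentiable (fun q => inner q w) q.
Proof. apply: (@linear_differentiable _ _ _ (innerL w)); exact: continuous_inner. Qed.

Lemma derive_inner w q v : 'D_v (fun q => inner q w) q = inner v w.
Proof.
rewrite deriveE; last exact: differentiable_inner.
by rewrite (@diff_lin _ _ _ (innerL w))//; exact: continuous_inner.
Qed.

Lemma class_C_inner k w : class_C k (fun q => inner q w).
Proof.
case: k => [|k]; first exact: continuous_inner.
split=> [q|v]; first exact: differentiable_inner.
rewrite (_ : 'D_v _ = fun=> inner v w); first exact: class_C_cst.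
by apply/funext => q; exact: derive_inner.
Qed.

Lemma class_C_sqr_enorm k : class_C k (fun q => enorm q ^+ 2).
Proof.
under eq_fun do rewrite sqr_enorm.
apply: class_C_sum => i; under eq_fun do rewrite -inner_delta_mxl innerC.
by apply: class_CM; exact: class_C_inner.
Qed.

Lemma derive_sqr_enorm q v :
  'D_v (fun q => enorm q ^+ 2) q = 2%:R * inner v q.
Proof.
have coordE i : (fun q : 'cV[R]_d => q i 0) = fun q => inner q (delta_mx i 0).
  by apply/funext => p; rewrite innerC inner_delta_mxl.
have dc i : is_derive q v (fun q : 'cV[R]_d => q i 0) (v i 0).
  rewrite coordE; split; first exact/diff_derivable/differentiable_inner.
  by rewrite derive_inner innerC inner_delta_mxl.
(* As a sum of products of coordinate functions, the squared norm is differentiated by instance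
   inference from [dc]. *)
rewrite (_ : (fun _ => _) =
    \sum_(i < d) ((fun q : 'cV[R]_d => q i 0) * (fun q : 'cV[R]_d => q i 0))).
  rewrite derive_val /inner mulr_sumr; apply: eq_bigr => i _.
  by rewrite /GRing.scale/= mulrC; ring.
by apply/funext => p; rewrite sqr_enorm fct_sumE.
Qed.

End InnerCalculus.

(** * One-variable derivative bounds *)

Lemma lipschitz_derive1 {R : realType} (f : R -> R) (M : R) (a b : R) :
  (forall x, differentiable f x) -> (forall x, `|(f^`() x)%classic| <= M) ->
  `|f a - f b| <= M * `|a - b|.
Proof.
move=> df fM; wlog ba : a b / b <= a => [W|].
  by have [/W //|/ltW /W] := leP b a; rewrite distrC (distrC b).
have [||c _ ->] := @MVT_segment _ f f^`() _ _ ba.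
- by move=> x _; rewrite derive1E; apply/derivableP/derivable1_diffP.
- by apply/continuous_subspaceT => x; exact/differentiable_continuous/df.
by rewrite normrM ler_wpM2r.
Qed.

Lemma le_sup_abs {R : realType} (f : R -> R) t :
  bounded_abs f -> `|f t| <= sup_abs f.
Proof. by move=> bf; apply: ub_le_sup => //; exists t. Qed.

Lemma derive1_comp2 {R : realType} (f g : R -> R) t :
  differentiable f (g t) -> differentiable g t ->
  (fun s => f (g s))^`() t = (f^`() (g t))%classic * (g^`() t)%classic.
Proof. by move=> df dg; rewrite derive1E derive_comp_real -?derive1E. Qed.

(** * Mean of ridge functions with quadratic regularization *)

Section RegularizedRidgeSum.
Context {R : realType} {d n : nat}.
Variables (iota : R) (x : 'I_n -> 'cV[R]_d) (g : 'I_n -> R -> R) (G1 G2 : R).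
Hypotheses (n_gt0 : (0 < n)%N) (iota_gt0 : 0 < iota).
Hypothesis gC2 : forall i, class_C 2 (g i).
Hypothesis g_ge0 : forall i t, 0 <= g i t.
Hypothesis g1_le : forall i t, `|((g i)^`() t)%classic| <= G1.
Hypothesis g2_le : forall i t, `|((g i)^`()^`() t)%classic| <= G2.
Implicit Types p q : 'cV[R]_d.

Let B := \big[Num.max/0]_(i < n) enorm (x i).
Let C0 := G1 * B.

Definition ridge_sum q :=
  n%:R^-1 * (\sum_(i < n) g i (inner q (x i))) + iota / 2%:R * enorm q ^+ 2.

(** The gradient of the mean without the quadratic term; it stays bounded while the regularizer
    contributes exactly [iota *: q]. *)
Definition ridge_grad q : 'cV[R]_d :=
  n%:R^-1 *: \sum_(i < n) ((g i)^`() (inner q (x i)))%classic *: x i.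

Let x_le i : enorm (x i) <= B.
Proof. exact: le_bigmax. Qed.

Let B_ge0 : 0 <= B.
Proof. exact: bigmax_ge_id. Qed.

Let dg i t : differentiable (g i) t.
Proof. by have [] := gC2 i. Qed.

(** [G1] dominates an absolute value as soon as one index exists, which [n_gt0] provides. *)
Let G1_ge0 : 0 <= G1.
Proof. exact: le_trans (g1_le (Ordinal n_gt0) 0). Qed.

Let G2_ge0 : 0 <= G2.
Proof. exact: le_trans (g2_le (Ordinal n_gt0) 0). Qed.

Let C0_ge0 : 0 <= C0.
Proof. exact: mulr_ge0. Qed.

Let mean_le (F : 'I_n -> R) c :
  (forall i, F i <= c) -> n%:R^-1 * (\sum_(i < n) F i) <= c.
Proof.
move=> Fc; rewrite ler_pdivrMl ?ltr0n// mulr_natl.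
rewrite -[n in c *+ n]card_ord -sumr_const.
exact: ler_sum.
Qed.

Let enorm_mean_le (F : 'I_n -> 'cV[R]_d) c :
  (forall i, enorm (F i) <= c) -> enorm (n%:R^-1 *: \sum_(i < n) F i) <= c.
Proof.
move=> Fc; rewrite enormZ ger0_norm ?invr_ge0 ?ler0n//.
apply: le_trans (mean_le Fc).
by rewrite ler_wpM2l ?invr_ge0 ?ler0n// enorm_sum.
Qed.

Lemma class_C_ridge_sum : class_C 2 ridge_sum.
Proof.
apply: class_CD; apply: class_CM; try exact: class_C_cst.
  by apply: class_C_sum => i; apply: class_C_comp => //; exact: class_C_inner.
exact: class_C_sqr_enorm.
Qed.

Lemma ridge_sum_ge0 q : 0 <= ridge_sum q.
Proof.
rewrite addr_ge0// mulr_ge0 ?invr_ge0 ?ler0n ?sumr_ge0 ?sqr_ge0//.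
by rewrite divr_ge0 ?ler0n// ltW.
Qed.

Lemma gradient_ridge_sum q : gradient ridge_sum q = ridge_grad q + iota *: q.
Proof.
apply/matrixP => j k; rewrite ord1 !mxE -!inner_delta_mxl.
set v := delta_mx j 0.
rewrite (innerC v (\sum_(i < n) _)) inner_suml.
under [in RHS]eq_bigr do rewrite innerZl (innerC _ v).
have dgx i : is_derive q v (fun q => g i (inner q (x i)))
    (((g i)^`() (inner q (x i)))%classic * inner v (x i)).
  split; last by rewrite derive_comp_real ?derive_inner//; exact: differentiable_inner.
  apply: diff_derivable; apply: differentiable_comp => //.
  exact: differentiable_inner.
have de : is_derive q v (fun q => enorm q ^+ 2) (2%:R * inner v q).
  split; last exact: derive_sqr_enorm.
  by apply: diff_derivable; have [] := @class_C_sqr_enorm R d 1.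
(* Recast with the operations on functions, so that [dgx] and [de] combine into the derivative of
   the whole expression. *)
rewrite (_ : ridge_sum =
    n%:R^-1 *: (\sum_(i < n) (fun q => g i (inner q (x i)))) +
    (iota / 2%:R) *: (fun q => enorm q ^+ 2)); last first.
  by apply/funext => p; rewrite /ridge_sum fctE /= fct_sumE.
rewrite derive_val /GRing.scale/=; congr (_ + _) => //; by field.
Qed.

Lemma enorm_ridge_grad_le q : enorm (ridge_grad q) <= C0.
Proof.
by apply: enorm_mean_le => i; rewrite enormZ ler_pM ?enorm_ge0.
Qed.

Lemma elipschitz_gradient_ridge_sum :
  elipschitz (iota + G2 * B ^+ 2) (gradient ridge_sum).
Proof.
move=> p q; rewrite !gradient_ridge_sum opprD addrACA -!scalerBr addrC.
rewrite mulrDl (le_trans (enormD _ _))// enormZ gtr0_norm// lerD2l.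
rewrite -sumrB; apply: enorm_mean_le => i.
rewrite -scalerBl enormZ.
have [dg1 _] := class_C_derive1 (gC2 i).
have := lipschitz_derive1 (inner p (x i)) (inner q (x i)) dg1 (g2_le i).
rewrite -innerBl => h.
(* This factor [B] comes from Cauchy-Schwarz; the second one in the Lipschitz constant is the bound
   on the norm of [x i] itself. *)
have {}h : `|((g i)^`() (inner p (x i)))%classic -
                ((g i)^`() (inner q (x i)))%classic|
    <= G2 * (enorm (p - q) * B).
  rewrite (le_trans h)// ler_wpM2l// (le_trans (cauchy_schwarz_inner _ _))//.
  by rewrite ler_wpM2l ?enorm_ge0.
apply: (@le_trans _ _ (G2 * (enorm (p - q) * B) * B)).
  by rewrite ler_pM ?enorm_ge0.
by rewrite le_eqVlt; apply/orP; left; apply/eqP; ring.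
Qed.

Lemma inner_gradient_ridge_sum_ge q :
  iota / 2%:R * enorm q ^+ 2 - C0 ^+ 2 / (2%:R * iota)
    <= inner (gradient ridge_sum q) q.
Proof.
rewrite gradient_ridge_sum innerDl innerZl -sqr_enorm.
have cs := cauchy_schwarz_inner (ridge_grad q) q.
have := ler_wpM2r (enorm_ge0 q) (enorm_ridge_grad_le q).
move=> /(le_trans cs); rewrite ler_norml => /andP[h _].
have i0 : iota != 0 by rewrite gt_eqF.
(* Expanding this square is Young's inequality with exactly the constants required. *)
have : 0 <= iota / 2%:R * (enorm q - C0 / iota) ^+ 2.
  by rewrite mulr_ge0 ?sqr_ge0// divr_ge0 ?ler0n// ltW.
have -> : iota / 2%:R * (enorm q - C0 / iota) ^+ 2 =
  iota / 2%:R * enorm q ^+ 2 - C0 * enorm q + C0 ^+ 2 / (2%:R * iota) by field.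
move: h; lra.
Qed.

Lemma dissipative_ridge_sum (gamma : R) : dissipative gamma ridge_sum.
Proof.
(* [K] is the value of [ridge_sum] at the origin and [D] the constant left by Young's inequality. *)
pose K := n%:R^-1 * (\sum_(i < n) g i 0); pose D := C0 ^+ 2 / (2%:R * iota).
have i0 : iota != 0 by rewrite gt_eqF.
have D_ge0 : 0 <= D.
  by rewrite divr_ge0 ?sqr_ge0// mulr_ge0 ?ler0n// ltW.
have K_ge0 : 0 <= K by rewrite mulr_ge0 ?invr_ge0 ?ler0n ?sumr_ge0.
have U_le q : ridge_sum q <= K + D + iota * enorm q ^+ 2.
  (* Each [g i] is [G1]-Lipschitz, so it exceeds its value at 0 by at most G1 |<q, x_i>| <= C0
     |q|. *)
  have UK : ridge_sum q <= K + C0 * enorm q + iota / 2%:R * enorm q ^+ 2.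
    rewrite lerD2r -lerBlDl -mulrBr -sumrB; apply: mean_le => i.
    apply: le_trans (ler_norm _) _.
    apply: le_trans (lipschitz_derive1 _ _ (dg i) (g1_le i)) _.
    rewrite subr0 -mulrA ler_wpM2l// mulrC.
    by rewrite (le_trans (cauchy_schwarz_inner _ _))// ler_wpM2l ?enorm_ge0.
  apply: le_trans UK _.
  have : 0 <= iota / 2%:R * (enorm q - C0 / iota) ^+ 2.
    by rewrite mulr_ge0 ?sqr_ge0// divr_ge0 ?ler0n// ltW.
  have -> : iota / 2%:R * (enorm q - C0 / iota) ^+ 2 =
    iota / 2%:R * enorm q ^+ 2 - C0 * enorm q + D by rewrite /D; field.
  lra.
have den_gt0 : 0 < 4%:R * iota + gamma ^+ 2.
  by rewrite ltr_pwDl ?sqr_ge0// mulr_gt0// ltr0n.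
(* [lambda * (iota + gamma^2 / 4) = iota / 4] absorbs the whole quadratic part *)
pose lambda := iota / (4%:R * iota + gamma ^+ 2).
have lambda_gt0 : 0 < lambda by rewrite divr_gt0.
(* The first term pays for the constant in [U_le], the second for half of the constant in the
   gradient lower bound, and the 1 makes the sum strictly positive. *)
exists lambda, (lambda * (K + D) + D / 2%:R + 1); split => //.
- by rewrite ler_pdivrMr// mulrDr mulKf ?pnatr_eq0// lerDl mulr_ge0 ?sqr_ge0.
- by rewrite ltr_pwDr// addr_ge0 ?divr_ge0// mulr_ge0 ?addr_ge0// ltW.
move=> q; rewrite innerC.
have := inner_gradient_ridge_sum_ge q; rewrite -/D.
have := ler_wpM2l (ltW lambda_gt0) (U_le q).
have -> : lambda * (K + D + iota * enorm q ^+ 2) =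
    lambda * (K + D) + iota / 4%:R * enorm q ^+ 2
    - lambda * (gamma ^+ 2 / 4%:R * enorm q ^+ 2).
  by rewrite /lambda; field; rewrite gt_eqF.
rewrite (mulrDr lambda (ridge_sum q)); lra.
Qed.

Lemma asymp_linear_gradient_ridge_sum :
  asymp_linear_gradient ridge_sum 1 iota%:M (fun r => C0 / r).
Proof.
split=> //.
- split=> [|q q0]; first exact: tr_scalar_mx.
  by rewrite mul_scalar_mx innerZr mulr_gt0// inner_gt0.
(* Inversion reverses the order on positive reals, and r >= 1 keeps both arguments positive. *)
- move=> r s r1 rs; rewrite ler_wpM2l// lef_pV2 ?posrE//.
    by rewrite (lt_le_trans _ (le_trans r1 rs)).
  by rewrite (lt_le_trans _ r1).
- rewrite -[X in _ --> X](mulr0 C0); apply: cvgMr.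
  apply/gtr0_cvgV0 => //; exact: nbhs_pinfty_gt.
(* Subtracting iota q leaves [ridge_grad q], and the right-hand side simplifies to [C0] because |q|
   >= 1 is nonzero. *)
move=> q q1; rewrite gradient_ridge_sum mul_scalar_mx addrK.
rewrite divfK ?enorm_ridge_grad_le//.
by rewrite gt_eqF// (lt_le_trans _ q1).
Qed.

End RegularizedRidgeSum.

(** * Derivative bounds for the composite loss phi(c - h(t)) *)

Section Loss.
Context {R : realType}.
Variables (c : R) (h phi : R -> R).
Hypotheses (hC2 : class_C 2 h) (phiC2 : class_C 2 phi).
Hypotheses (h1_bounded : bounded_abs h^`()) (h2_bounded : bounded_abs h^`(2)).
Hypotheses (phi1_bounded : bounded_abs phi^`())
  (phi2_bounded : bounded_abs phi^`(2)).

Let dh t : differentiable h t. Proof. by have [] := hC2. Qed.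
Let dphi t : differentiable phi t. Proof. by have [] := phiC2. Qed.
Let dh1 t : differentiable h^`() t.
Proof. by have [] := class_C_derive1 hC2. Qed.
Let dphi1 t : differentiable phi^`() t.
Proof. by have [] := class_C_derive1 phiC2. Qed.

Let inner_derive (t : R) : is_derive t (1 : R) (fun s : R => c - h s)
  (- (h^`() t)%classic).
Proof.
have hd : is_derive t (1 : R) h (h^`() t)%classic.
  by rewrite derive1E; apply/derivableP/derivable1_diffP.
have : is_derive t (1 : R) (cst c - h) (0 - (h^`() t)%classic) by exact: is_deriveB.
by rewrite sub0r.
Qed.

Let inner_diff (t : R) : differentiable (fun s => c - h s) t.
Proof. by apply/derivable1_diffP; have [] := inner_derive t. Qed.

Lemma class_C_loss : class_C 2 (fun t => phi (c - h t)).
Proof.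
exact: (class_C_comp phiC2 (class_CD (class_C_cst 2 c) (class_CN hC2))).
Qed.

(** Stated between functions rather than pointwise, so that it can be rewritten under a second
    derivative. *)
Lemma derive1_loss : (fun t => phi (c - h t))^`()%classic =
  fun t => - ((phi^`() (c - h t))%classic * (h^`() t)%classic).
Proof.
apply/funext => t; rewrite derive1_comp2// [X in _ * X]derive1E.
by have /@derive_val -> := inner_derive t; rewrite mulrN.
Qed.

Lemma derive1_loss_le t :
  `|((fun t => phi (c - h t))^`() t)%classic| <=
    sup_abs (phi^`())%classic * sup_abs (h^`())%classic.
Proof. by rewrite derive1_loss normrN normrM ler_pM// le_sup_abs. Qed.

(** Product rule applied to -phi'(c - h) h'. The inner derivative -h' cancels the outer sign in the
    phi'' term, while the h'' term keeps it. *)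
Lemma derive2_loss t : ((fun t => phi (c - h t))^`()^`() t)%classic =
  (phi^`(2) (c - h t))%classic * (h^`() t)%classic ^+ 2 -
  (phi^`() (c - h t))%classic * (h^`(2) t)%classic.
Proof.
rewrite derive1_loss.
have d1 : is_derive t (1 : R) (fun s => phi^`() (c - h s))%classic
    ((phi^`(2) (c - h t))%classic * - (h^`() t)%classic).
  apply: is_derive1_comp (inner_derive t).
  rewrite derive1nS derive1n1 derive1E.
  exact/derivableP/derivable1_diffP.
have d2 : is_derive t (1 : R) h^`()%classic (h^`(2) t)%classic.
  rewrite derive1nS derive1n1 derive1E.
  exact/derivableP/derivable1_diffP.
have := is_deriveN (is_deriveM d1 d2).
move=> /@derive_val; rewrite -derive1E /GRing.scale/= => ->; ring.
Qed.

Lemma derive2_loss_le t :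
  `|((fun t => phi (c - h t))^`()^`() t)%classic| <=
    sup_abs (phi^`(2))%classic * sup_abs (h^`())%classic ^+ 2 +
    sup_abs (phi^`())%classic * sup_abs (h^`(2))%classic.
Proof.
rewrite derive2_loss (le_trans (ler_normB _ _))// lerD// normrM ler_pM//.
- exact: le_sup_abs.
(* Squaring preserves the bound because the supremum is nonnegative, as it dominates the absolute
   value at the point 0. *)
- by rewrite normrX lerXn2r ?nnegrE// ?le_sup_abs// (le_trans _ (le_sup_abs 0 _)).
- exact: le_sup_abs.
- exact: le_sup_abs.
Qed.

End Loss.

Theorem proposition5p11 (R : realType) (d n : nat) (gamma iota : R)
  (x : 'I_n -> 'cV[R]_d) (y : 'I_n -> R) (h phi : R -> R)
  (n_gt0 : (0 < n)%N) (gamma_gt0 : 0 < gamma) (iota_gt0 : 0 < iota)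
  (y01 : forall i, y i = 0 \/ y i = 1)
  (hC2 : class_C 2 h)
  (h1_bounded : bounded_abs h^`()) (h2_bounded : bounded_abs h^`(2))
  (phi_ge0 : forall t, 0 <= phi t)
  (phiC2 : class_C 2 phi)
  (phi1_bounded : bounded_abs phi^`()) (phi2_bounded : bounded_abs phi^`(2)) :
  let U : 'cV[R]_d -> R := fun q =>
    n%:R^-1 * (\sum_(i < n) phi (y i - h (inner q (x i))))
    + iota / 2%:R * enorm q ^+ 2 in
  let Bx := \big[Num.max/0]_(i < n) enorm (x i) in
  let H1 := sup_abs h^`() in
  let H2 := sup_abs h^`(2) in
  let Phi1 := sup_abs phi^`() in
  let Phi2 := sup_abs phi^`(2) in
  let L := iota + (Phi2 * H1 ^+ 2 + Phi1 * H2) * Bx ^+ 2 in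
  let C0 := Phi1 * H1 * Bx in
  [/\ [/\ class_C 2 U, forall q, 0 <= U q & elipschitz L (gradient U)],
      dissipative gamma U /\
      (forall q, iota / 2%:R * enorm q ^+ 2 - C0 ^+ 2 / (2%:R * iota)
                 <= inner (gradient U q) q) &
      asymp_linear_gradient U 1 iota%:M (fun r => C0 / r)].
Proof.
move=> U Bx H1 H2 Phi1 Phi2 L C0.
(* With these profiles [U] unfolds to [ridge_sum iota x g], and the bounds on the loss take the
   roles of [G1] and [G2]. *)
pose g i t := phi (y i - h t).
have gC2 i : class_C 2 (g i) by exact: class_C_loss.
have g1_le i t : `|((g i)^`() t)%classic| <= Phi1 * H1 by exact: derive1_loss_le.
have g2_le i t : `|((g i)^`()^`() t)%classic| <= Phi2 * H1 ^+ 2 + Phi1 * H2.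
  exact: derive2_loss_le.
have g_ge0 i t : 0 <= g i t by exact: phi_ge0.
split; [split|split|].
- exact: (class_C_ridge_sum iota x gC2).
- exact: (ridge_sum_ge0 x iota_gt0 g_ge0).
- exact: (elipschitz_gradient_ridge_sum x n_gt0 iota_gt0 gC2 g2_le).
- exact: (dissipative_ridge_sum x n_gt0 iota_gt0 gC2 g_ge0 g1_le).
- exact: (inner_gradient_ridge_sum_ge x n_gt0 iota_gt0 gC2 g1_le).
- exact: (asymp_linear_gradient_ridge_sum x n_gt0 iota_gt0 gC2 g1_le).
Qed.
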